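(* Let $\epsilon>0$. Let $(\mathbf d_n)_n$ be degree sequences satisfying Assumption A (stated in the context) and $\Delta|Q|=o(R)$ as $n\to\infty$, where $\Delta=\Delta_n$, $Q=Q_n$, $R=R_n$. If $Q\le -\omega(n)\,n^{-1/3}R^{2/3}$ for some $\omega(n)\to\infty$, then $$\mathbb P\left(L_1(\mathbb{CM}_n(\mathbf d_n))\le (1+\epsilon)\frac{2R}{Q^2}\log\left(\frac{|Q|^3n}{R^2}\right)\right)=1-o(1)\quad (n\to\infty).$$
   Context: Asymptotics are as $n\to\infty$. For each $n$, $\mathbf d_n=(d_1,\dots,d_n)$ is a degree sequence on $[n]=\{1,\dots,n\}$ with integers $1\le d_1\le\dots\le d_n$ and $m=\sum_{i\in[n]}d_i$ even; $\Delta_n=d_n$ is the maximum degree. Define $Q_n=\frac1m\sum_{i\in[n]}d_i(d_i-2)$ and $R_n=\frac1m\sum_{i\in[n]}d_i(d_i-2)^2$. The configuration model $\mathbb{CM}_n=\mathbb{CM}_n(\mathbf d_n)$ is the random multigraph on $[n]$ obtained by giving $d_i$ half-edges to vertex $i$ and pairing all half-edges uniformly at random. For a (multi)graph $G$ on $[n]$, $L_1(G)$ is the order (number of vertices) of a largest connected component. $D_n$ is the degree of a uniformly random vertex of $[n]$. For integers $b$ and $h\geq 1$, $\mathcal L(b,h)=\{b+hk:k\in\mathbb Z\}$. Let $h_n$ be the largest integer $h$ such that $\mathbb P(D_n\in\mathcal L(b,h))=1$ for some $b$. Assumption A: there exists a discrete random variable $D$ supported on $\mathbb Z_{\ge0}$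 such that (i) $D_n\to D$ in distribution; (ii) $Q_n\to0$; (iii) $\mathbb P(D\notin\{0,2\})>0$; (iv) if $h$ is the largest integer such that $\mathbb P(D\in\mathcal L(b,h))=1$ for some $b$, then $h_n=h$ for all $n$; (v) $\mathbb E(D_n^4)\le\Delta_n^{1/2}$. *)

(* Defs.v *)
From HB Require Import structures.
From mathcomp Require Import all_boot all_order all_algebra.
From mathcomp Require Import all_classical all_reals all_analysis.

Set Implicit Arguments.
Unset Strict Implicit.
Unset Printing Implicit Defensive.

Import Order.TTheory GRing.Theory Num.Theory.
Import numFieldNormedType.Exports.

Local Open Scope classical_set_scope.
Local Open Scope ring_scope.

Definition uniform_pr (R : realType) (T : finType) (A : pred T) : R :=
  #|A|%:R / #|T|%:R.

(* Vertices are 'I_n = {0, ..., n - 1} instead of {1, ..., n}. *)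
Definition degree_sequence (n : nat) (d : 'I_n -> nat) : Prop :=
  [/\ forall i, (0 < d i)%N,
      {homo d : i j / (i <= j)%N} &
      ~~ odd (\sum_i d i)%N].

Section DegreeStatistics.
Variables (R : realType) (n : nat) (d : 'I_n -> nat).

Definition total_degree : nat := (\sum_i d i)%N.

Definition max_degree : nat := (\max_i d i)%N.

Definition Qn : R :=
  (total_degree%:R)^-1 * \sum_i (d i)%:R * ((d i)%:R - 2).

Definition Rn : R :=
  (total_degree%:R)^-1 * \sum_i (d i)%:R * ((d i)%:R - 2) ^+ 2.

(* The law of D_n, the degree of a uniformly random vertex. *)
Definition degree_law (A : set R) : \bar R :=
  (uniform_pr R [pred i | (d i)%:R \in A])%:E.

(* E(D_n ^ 4) *)
Definition degree_moment4 : R := n%:R^-1 * \sum_i (d i)%:R ^+ 4.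

End DegreeStatistics.

Definition lattice (R : realType) (b : int) (h : nat) : set R :=
  [set x | exists k : int, x = (b + h%:Z * k)%:~R].

(* [lattice_span mu h]: h is the largest integer >= 1 such that mu gives mass 1
   to some lattice of step h. No such h exists when mu is a point mass. *)
Definition lattice_span (R : realType) (mu : set R -> \bar R) (h : nat) : Prop :=
  [/\ (0 < h)%N,
      exists b : int, mu (lattice b h) = 1%:E &
      forall h' : nat, (0 < h')%N ->
        (exists b : int, mu (lattice b h') = 1%:E) -> (h' <= h)%N].

(* The conditions on the individual D_n (equality of spans, fourth moment) are
   required for all large n only: for n = 1 the variable D_1 is constant and has
   no largest span, so no sequence satisfies them for every n. *)
Definition assumption_A (R : realType) (d : forall n, 'I_n -> nat) : Prop :=
  exists (disp : measure_display) (T : measurableType disp)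
         (P : probability T R) (D : {dRV P >-> R}),
  [/\ P (D @^-1` range (fun k : nat => k%:R)) = 1%:E,
      forall x : R, {for x, continuous (cdf (D : {RV P >-> R}))} ->
        degree_law (d n) `]-oo, x] @[n --> \oo] --> cdf (D : {RV P >-> R}) x &
  [/\ Qn R (d n) @[n --> \oo] --> 0,
      (0 < P (D @^-1` ~` [set 0%R; 2%R]))%E,
      exists h : nat, lattice_span (distribution P D) h /\
        \forall n \near \oo, @lattice_span R (degree_law (d n)) h &
      \forall n \near \oo,
        degree_moment4 R (d n) <= Num.sqrt (max_degree (d n))%:R]].

(* Finite multigraphs on a fixed vertex set. The set of endpoints of a loop is a
   singleton. *)
Record multigraph (V : finType) := Multigraph {
  edge : finType;
  endpoints : edge -> {set V};
  card_endpoints : forall e, (0 < #|endpoints e| <= 2)%N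
}.

Definition adjacent (V : finType) (G : multigraph V) : rel V :=
  fun u v => [exists e : edge G, endpoints e == [set u; v]%SET].

(* Order of a largest connected component. *)
Definition L1 (V : finType) (G : multigraph V) : nat :=
  (\max_(v : V) #|connect (adjacent G) v|)%N.

Section ConfigurationModel.
Variables (n : nat) (d : 'I_n -> nat).

Definition half_edge : finType := {i : 'I_n & 'I_(d i)}.

Definition is_pairing (M : {set {set half_edge}}) : bool :=
  finset.partition M [set: half_edge]%SET && [forall B in M, #|B| == 2%N].

Definition pairing : finType := {M : {set {set half_edge}} | is_pairing M}.

Variable M : pairing.

Definition pairing_edge : finType := {B : {set half_edge} | B \in val M}.

Definition pairing_endpoints (e : pairing_edge) : {set 'I_n} :=
  [set tag x | x in val e]%SET.

Lemma card_pairing_endpoints e : (0 < #|pairing_endpoints e| <= 2)%N.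
Proof.
case: e => B BM; case/andP: (valP M) => _ /forallP /(_ B).
rewrite BM /= => /eqP B2; apply/andP; split.
  by rewrite card_gt0 imset_eq0 -card_gt0 B2.
by apply: leq_trans (leq_imset_card _ _) _; rewrite B2.
Qed.

Definition configuration_multigraph : multigraph 'I_n :=
  Multigraph card_pairing_endpoints.

End ConfigurationModel.

(* Probability that the random multigraph CM_n(d) has the property A. *)
Definition CM_pr (R : realType) (n : nat) (d : 'I_n -> nat)
    (A : pred (multigraph 'I_n)) : R :=
  uniform_pr R [pred M : pairing d | A (configuration_multigraph M)].

(* Main.v *)
Require Import Defs.
From HB Require Import structures.
From mathcomp Require Import all_boot all_order all_algebra.
From mathcomp Require Import all_classical all_reals all_analysis.
From mathcomp Require Import ring lra.

Set Implicit Arguments.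
Unset Strict Implicit.
Unset Printing Implicit Defensive.

Import Order.TTheory GRing.Theory Num.Theory.
Import numFieldNormedType.Exports.

Local Open Scope classical_set_scope.
Local Open Scope ring_scope.

(* Reveal the component of a vertex v by repeatedly pairing an active half-edge.
   With X the number of active half-edges, theta = |Q| / R and c close to
   Q^2 / (2 R), the process exp (theta X) (1 - c)^(-t) is a supermartingale as
   long as few vertices have been explored: the expectation of
   exp (theta (D - 2)) - 1 under the size-biased law is about
   theta Q + theta^2 R / 2 = - Q^2 / (2 R), pairing two active half-edges only
   lowers X, and removing a vertex raises the drift by at most theta / m. At the
   end of the exploration X = 0, so E ((1 - c)^(- |C(v)| + 1) - 1) is at most
   exp (theta d_v) - 1, which is about theta d_v; comparing with 0 and not with 1
   gains the factor theta that a plain Chernoff bound misses. Summing over v, and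
   using that a component of order > j is seen from more than j vertices, bounds
   P (L_1 > j) by 2 theta m / ((j + 1) ((1 - c)^(-j) - 1)). For j about
   (1 + eps) (2 R / Q^2) ln L with L = |Q|^3 n / R^2 this is O (L^(- eps / 2)). *)

(** * Perfect matchings of a finite set: decomposition and counting *)

Section Pairings.
Import mathcomp.boot.finset.
Local Open Scope set_scope.
Variable H : finType.
Implicit Types (S B : {set H}) (M : {set {set H}}).

Definition pairing_on S M : bool :=
  partition M S && [forall B in M, #|B| == 2%N].

(** The double factorial [(s - 1)!!] for even [s], and 0 for odd [s]. *)
Fixpoint npairings (s : nat) : nat :=
  match s with 0 => 1 | 1 => 0 | s'.+2 => s'.+1 * npairings s' end.

Lemma npairings_gt0 s : ~~ odd s -> (0 < npairings s)%N.
Proof.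
elim/ltn_ind: s => -[|[|s]] // IH /=; rewrite negbK => os.
by rewrite muln_gt0 /= IH.
Qed.

Lemma pairing_on_block S M B : pairing_on S M -> B \in M -> B \subset S.
Proof. by case/andP=> /partitionS PS _ /PS. Qed.

Lemma pairing_onD1 S M B :
  pairing_on S M -> B \in M -> pairing_on (S :\: B) (M :\ B).
Proof.
case/andP=> PM /forall_inP cM BM; rewrite /pairing_on partitionD1 //=.
by apply/forall_inP => C /setD1P[_ /cM].
Qed.

Lemma pairing_onU1 S M B : B \subset S -> #|B| = 2%N ->
  pairing_on (S :\: B) M -> pairing_on S (B |: M).
Proof.
move=> BS B2 /andP[PM /forall_inP cM]; apply/andP; split; last first.
  by apply/forall_inP => C /setU1P[->|/cM //]; rewrite B2.
have -> : S = B :|: (S :\: B).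
  by rewrite setUC setDE setUIl [~: B :|: B]setUC setUCr setIT; apply/esym/setUidPl.
apply: partitionU1 => //; first by rewrite -card_gt0 B2.
by rewrite -setI_eq0 setIDA setIC -setIDA setDv setI0.
Qed.

Lemma pairing_on_notin S M B : #|B| = 2%N -> pairing_on (S :\: B) M -> B \notin M.
Proof.
move=> B2 PM; apply/negP => /(pairing_on_block PM).
by rewrite subsetD -setI_eq0 setIid -cards_eq0 B2 andbF.
Qed.

Section Sum.
Variable (R : nmodType).

(** A pairing of [S] amounts to a partner [b] of [a] and a pairing of the rest. This is the one-step
    revelation behind both the count and the exploration. *)
Lemma sum_pairing_on (f : {set {set H}} -> R) S a : a \in S ->
  (\sum_(M | pairing_on S M) f M =
   \sum_(b in S :\ a) \sum_(M | pairing_on (S :\: [set a; b]) M) f ([set a; b] |: M))%R.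
Proof.
move=> aS.
(* The partner of [a] in [M]; the default [a] never occurs when [M] is a pairing of [S]. *)
pose pt M := odflt a [pick b in pblock M a :\ a].
have ptP M : pairing_on S M -> [set a; pt M] \in M /\ pt M \in S :\ a.
  move=> PM; have /andP[/and3P[/eqP cM tM _] /forall_inP c2] := PM.
  have aM : a \in cover M by rewrite cM.
  have BM := pblock_mem aM; have aB : a \in pblock M a by rewrite mem_pblock.
  have := c2 _ BM; rewrite (cardsD1 a) aB => /cards1P[b Eb].
  have -> : pt M = b.
    rewrite /pt; case: pickP => [c|/(_ b)]; rewrite Eb inE ?eqxx // => /eqP -> //.
  have -> : [set a; b] = pblock M a.
    by rewrite -(setD1K aB) Eb.
  split=> //.
  have : b \in pblock M a :\ a by rewrite Eb inE.
  rewrite !inE => /andP[-> bB].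
  exact: (fintype.subsetP (pairing_on_block PM BM)).
rewrite (partition_big pt (fun b => b \in S :\ a)) /=; last by move=> M /ptP[].
apply: eq_bigr => b; rewrite !inE => /andP[ba bS].
have B2 : #|[set a; b]| = 2%N by rewrite cards2 eq_sym ba.
have BS : [set a; b] \subset S by apply/fintype.subsetP => x /set2P[] ->.
rewrite (reindex_onto (fun M => [set a; b] |: M) (fun M => M :\ [set a; b])) /=.
  apply: eq_bigl => M; apply/idP/idP => [/andP[/andP[PM /eqP pM] /eqP EM]|PM].
    by rewrite -EM pairing_onD1 // setU11.
  have PU := pairing_onU1 BS B2 PM.
  rewrite PU setU1K ?eqxx ?andbT //=; last exact: (pairing_on_notin B2 PM).
  have [pM pS] := ptP _ PU; have /andP[/and3P[_ tM _] _] := PU.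
  have := def_pblock tM pM (set21 _ _).
  rewrite (def_pblock tM (setU11 _ _) (set21 _ _)) => /setP /(_ (pt ([set a; b] |: M))).
  by move: pS; rewrite !inE eqxx orbT => /andP[/negPf-> _] /= ->.
by move=> M /andP[PM /eqP <-]; rewrite setD1K //; case: (ptP _ PM).
Qed.

End Sum.

Lemma card_pairing_on S : #|[set M | pairing_on S M]| = npairings #|S|.
Proof.
move Es : #|S| => s; elim/ltn_ind: s S Es => s IH S Es.
have [S0|[a aS]] := set_0Vmem S.
  rewrite -Es S0 cards0 /= -(cards1 (set0 : {set {set H}})); apply: eq_card => M.
  rewrite !inE /pairing_on partition_set0.
  by case: eqP => // -> /=; apply/forall_inP => B; rewrite inE.
rewrite -sum1_card (eq_bigl (pairing_on S)) => [|M]; last by rewrite inE.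
rewrite (sum_pairing_on _ aS) (eq_bigr (fun=> npairings s.-2)).
  rewrite sum_nat_const; have := cardsD1 a S; rewrite aS Es => ->.
  case: #|S :\ a| => [|k]; rewrite /= ?mul0n //.
move=> b; rewrite !inE => /andP[ba bS].
have Es2 : #|S :\: [set a; b]| = s.-2.
  by rewrite -Es (cardsD1 a S) aS (cardsD1 b (S :\ a)) !inE ba bS -setDDl.
rewrite sum1_card -(eq_card (A := [set M | pairing_on (S :\: [set a; b]) M])) => [|M].
  by apply: IH => //; rewrite -Es (cardsD1 a S) aS (cardsD1 b (S :\ a)) !inE ba bS /= !add1n ltnW.
by rewrite !inE.
Qed.

End Pairings.

(** * Exploration of one component by successive pairings *)

Section Exploration.
Import mathcomp.boot.finset mathcomp.boot.fintype.
Local Open Scope set_scope.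
Variables (R : realType) (V H : finType) (tau : H -> V).
Implicit Types (A : {set H}) (U W : {set V}) (M : {set {set H}}).

Definition halves W : {set H} := [set x | tau x \in W].

Definition deg w : nat := #|halves [set w]|.

Lemma card_halves W : #|halves W| = (\sum_(w in W) deg w)%N.
Proof.
rewrite -sum1_card (partition_big tau (mem W)) /=; last by move=> x; rewrite inE.
apply: eq_bigr => w wW; rewrite /deg -sum1_card; apply: eq_bigl => x.
by rewrite !inE; case: eqP => [->|]; rewrite ?wW ?andbF.
Qed.

Lemma sum_halves W (F : V -> R) :
  (\sum_(x in halves W) F (tau x) = \sum_(w in W) (deg w)%:R * F w)%R.
Proof.
rewrite (partition_big tau (mem W)) /=; last by move=> x; rewrite inE.
apply: eq_bigr => w wW; rewrite mulr_natl /deg -sumr_const.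
rewrite (eq_bigr (fun=> F w)) => [|x /andP[_ /eqP->] //].
by apply: eq_bigl => x; rewrite !inE; case: eqP => [->|]; rewrite ?wW ?andbF.
Qed.

Variables (C : {set {set H}} -> {set V}) (v : V).

(** [C M] stands for the component of [v] in the graph formed by the pairs [M]; it enters the
    exploration through this closure property. *)
Hypothesis C_closed : forall U M, v \notin U ->
  (forall B, B \in M -> B \subset halves U \/ B \subset halves (~: U)) ->
  C M :&: U = set0.

Variables (theta c : R) (k : nat).
Hypothesis theta_ge0 : (0 <= theta)%R.
Hypotheses (c_ge0 : (0 <= c)%R) (c_lt1 : (c < 1)%R).
(** Reaching [w] uses up one active half-edge and activates [deg w - 1] others, so it multiplies
    [expR (theta * X)] by [expR (theta * (deg w - 2))]. Any of the [deg w] half-edges of [w] can be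
    hit, whence the size-biased weights. *)
Hypothesis drift : forall U, (#|~: U| <= k)%N ->
  (\sum_(w in U) (deg w)%:R * (expR (theta * ((deg w)%:R - 2)) - 1) <= - (c * #|H|%:R))%R.

Let z : R := ((1 - c)^-1)%R.

Let z_ge1 : (1 <= z)%R.
Proof. by rewrite /z invf_ge1 ?subr_gt0 // gerBl. Qed.

(* [A]: active half-edges; [U]: unexplored vertices; [M0]: revealed pairs. Only
   newly reached vertices are counted, whence the exponent of [z]. *)
Lemma exploration_bound j A U M0 :
  v \notin U -> A \subset halves (~: U) ->
  (forall B, B \in M0 -> B \subset halves (~: U)) ->
  (#|~: U| + j <= k.+1)%N ->
  (\sum_(M | pairing_on (A :|: halves U) M) z ^+ minn #|C (M0 :|: M) :&: U| j
    <= (npairings #|A :|: halves U|)%:R * expR (theta * #|A|%:R))%R.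
Proof.
move En : #|A :|: halves U| => n.
elim/ltn_ind: n j A U M0 En => n IH j A U M0 En vU AU M0U kj.
(* If no further vertex is counted, the sum is the number of pairings, and the exponential on the
   right is at least 1. *)
have triv : (forall M, pairing_on (A :|: halves U) M -> minn #|C (M0 :|: M) :&: U| j = 0%N) ->
    (\sum_(M | pairing_on (A :|: halves U) M) z ^+ minn #|C (M0 :|: M) :&: U| j
    <= (npairings n)%:R * expR (theta * #|A|%:R))%R.
  move=> h; rewrite (eq_bigr (fun=> 1%R)) => [|M /h -> //].
  rewrite sumr_const -En -card_pairing_on cardsE ler_peMr ?ler0n //.
  by rewrite -(expR0 R) ler_expR mulr_ge0.
case: j => [|j] in kj triv *; first by apply: triv => M _; rewrite minn0.
(* Without active half-edges no pair, revealed or not, joins [U] to its complement: the exploration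
   is over. *)
have [A0|[a aA]] := set_0Vmem A.
  apply: triv => M PM; rewrite C_closed ?cards0 ?min0n // => B /setUP[/M0U|BM]; first by right.
  by left; rewrite (subset_trans (pairing_on_block PM BM)) // A0 set0U.
have aS : a \in A :|: halves U by rewrite inE aA.
have aU : tau a \notin U by have := subsetP AU _ aA; rewrite !inE.
have disj x : x \in A -> tau x \notin U by move=> /(subsetP AU); rewrite !inE.
have dAU : disjoint (mem A) (mem (halves U)).
  rewrite -setI_eq0; apply/eqP/setP => x; rewrite !inE.
  by apply/negP => /andP[/disj/negP xU]; exact: xU.
have [n2|n2] := ltnP n 2.
  apply: triv => M PM; have : (0 < #|[set M | pairing_on (A :|: halves U) M]|)%N.
    by apply/card_gt0P; exists M; rewrite inE.
  by rewrite card_pairing_on En; move: n2 En; case: (n) => [|[]] // _; rewrite (cardsD1 a) aS.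
rewrite (sum_pairing_on _ aS).
have cS b : b \in (A :|: halves U) :\ a -> #|(A :|: halves U) :\: [set a; b]| = n.-2 /\ n = n.-2.+2.
  rewrite !inE => bS.
  by rewrite -En (cardsD1 a (A :|: _)) (cardsD1 b (_ :\ a)) !inE aA /= bS setDDl.
have -> : (A :|: halves U) :\ a = (A :\ a) :|: halves U.
  by apply/setP => x; rewrite !inE; case: eqP => // ->; rewrite (negPf aU).
rewrite (eq_bigl [predU A :\ a & halves U]) => [|b]; last by rewrite !inE.
rewrite bigU /=; last exact: disjointWl (subsetDl _ _) dAU.
pose E0 : R := ((npairings n.-2)%:R * expR (theta * #|A|%:R))%R.
have E0_ge0 : (0 <= E0)%R by rewrite mulr_ge0 ?ler0n ?expR_ge0.
(* Pairing two active half-edges reaches no new vertex and shrinks [A], which only lowers the bound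
   as [theta >= 0]. *)
have back b : b \in A :\ a ->
  (\sum_(M | pairing_on ((A :|: halves U) :\: [set a; b]) M)
    z ^+ minn #|C (M0 :|: ([set a; b] |: M)) :&: U| j.+1 <= E0)%R.
  move=> bAa; have [bS bA] : b \in (A :|: halves U) :\ a /\ b \in A.
    by move: bAa; rewrite !inE => /andP[-> ->].
  have [cSb nn] := cS b bS.
  have eS : (A :|: halves U) :\: [set a; b] = (A :\: [set a; b]) :|: halves U.
    apply/setP => x; rewrite !inE; case: eqP => [->|_] /=; first by rewrite (negPf aU).
    by case: eqP => // ->; rewrite (negPf (disj _ bA)).
  rewrite eS in cSb *.
  under eq_bigr do rewrite setUA [M0 :|: _]setUC.
  apply: le_trans (IH _ _ _ _ _ _ cSb vU _ _ kj) _.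
  - by rewrite nn.
  - exact: subset_trans (subsetDl _ _) AU.
  - move=> B /setU1P[->|/M0U //]; apply/subsetP => x /set2P[] ->; exact: (subsetP AU).
  - rewrite ler_wpM2l ?ler0n // ler_expR ler_wpM2l // ler_nat subset_leq_card //.
    exact: subsetDl.
(* A new vertex [w] costs one factor [z] and changes [#|A|] by [deg w - 2]; lowering [j] by one
   makes up for the removal of [w] from [U]. *)
have new b : b \in halves U ->
  (\sum_(M | pairing_on ((A :|: halves U) :\: [set a; b]) M)
    z ^+ minn #|C (M0 :|: ([set a; b] |: M)) :&: U| j.+1
   <= E0 * z * expR (theta * ((deg (tau b))%:R - 2)))%R.
  move=> bU; have wU : tau b \in U by move: bU; rewrite inE.
  have ba : b != a by apply: contraNneq aU => <-.
  have bS : b \in (A :|: halves U) :\ a by rewrite in_setD1 ba in_setU bU orbT.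
  have [cSb nn] := cS b bS.
  set w := tau b in wU *; pose A' := (A :\ a) :|: (halves [set w] :\ b).
  have eS : (A :|: halves U) :\: [set a; b] = A' :|: halves (U :\ w).
    have bA : b \notin A by apply/negP => /disj; rewrite -/w wU.
    have aw : tau a != w by apply: contraNneq aU => ->.
    apply/setP => x; rewrite !inE.
    have [->|xa] /= := eqVneq x a.
      by rewrite (negPf aw) (negPf aU) !andbF.
    have [->|xb] /= := eqVneq x b; first by rewrite (negPf bA) -/w eqxx.
    by have [->|] := eqVneq (tau x) w; rewrite ?wU ?orbT ?orbF //= ?orbF.
  have cA' : (#|A'|%:R = #|A|%:R + (deg w)%:R - 2 :> R)%R.
    have -> : #|A'| = (#|A :\ a| + #|halves [set w] :\ b|)%N.
      rewrite cardsU; have -> : (A :\ a) :&: (halves [set w] :\ b) = set0;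
        last by rewrite cards0 subn0.
      apply/setP => x; rewrite !inE; apply/negP => /andP[/andP[_ /disj xU] /andP[_ /eqP xw]].
      by rewrite xw wU in xU.
    rewrite (cardsD1 a A) aA /deg (cardsD1 b (halves [set w])) !inE eqxx /= !natrD.
    ring.
  rewrite eS in cSb *.
  under eq_bigr do rewrite setUA [M0 :|: _]setUC.
  have step : (\sum_(M | pairing_on (A' :|: halves (U :\ w)) M)
     z ^+ minn #|C ([set a; b] |: M0 :|: M) :&: U| j.+1 <=
     z * \sum_(M | pairing_on (A' :|: halves (U :\ w)) M)
     z ^+ minn #|C ([set a; b] |: M0 :|: M) :&: (U :\ w)| j)%R.
    rewrite mulr_sumr; apply: ler_sum => M _; rewrite -exprS ler_weXn2l //.
    rewrite -minnSS leq_min geq_minr andbT (leq_trans (geq_minl _ _)) //.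
    set X := C _; rewrite (cardsD1 w) -add1n leq_add ?leq_b1 // subset_leq_card //.
    by apply/subsetP => x; rewrite !inE => /and3P[-> -> ->].
  apply: le_trans step _; rewrite mulrAC [leRHS]mulrC ler_wpM2l ?(le_trans ler01) //.
  have cU : #|~: (U :\ w)| = #|~: U|.+1.
    have -> : ~: (U :\ w) = w |: ~: U.
      by apply/setP => x; rewrite !inE; case: eqP.
    by rewrite cardsU1 inE wU.
  have hU : halves (~: U) \subset halves (~: (U :\ w)).
    by apply/subsetP => x; rewrite !inE => /negPf ->; rewrite andbF.
  have hw : halves [set w] \subset halves (~: (U :\ w)).
    by apply/subsetP => x; rewrite !inE => /eqP ->; rewrite eqxx.
  apply: le_trans (IH _ _ _ _ _ _ cSb _ _ _ _) _.
  - by rewrite nn.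
  - by rewrite !inE (negPf vU) andbF.
  - rewrite subUset (subset_trans (subsetDl _ _)) ?(subset_trans AU) //=.
    exact: subset_trans (subsetDl _ _) hw.
  - move=> B /setU1P[->|/M0U BU]; last exact: subset_trans BU hU.
    apply/subsetP => x /set2P[] ->; first exact: (subsetP hU _ (subsetP AU _ aA)).
    by apply: (subsetP hw); rewrite !inE.
  - by rewrite cU addSnnS.
  - by rewrite /E0 -mulrA -expRD cA' mulrBr mulrBr mulrDr addrA.
apply: le_trans (lerD (ler_sum _ back) (ler_sum _ new)) _.
rewrite sumr_const -(mulr_sumr) (sum_halves U (fun w => expR (theta * ((deg w)%:R - 2)))).
have nn : (n.-2.+2 = n)%N by move: n2; case: (n) => [|[]].
have cA : (#|A :\ a|.+1 = #|A|)%N by rewrite (cardsD1 a A) aA.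
have cS1 : (n.-2.+1 = #|A :\ a| + \sum_(w in U) deg w)%N.
  apply: succn_inj; rewrite nn -En cardsU -card_halves -addSn cA.
  by move: dAU; rewrite -setI_eq0 => /eqP ->; rewrite cards0 subn0.
(* The half-edge [a] has [n - 1] possible partners. After division by [E0], the active ones account
   for equal terms on both sides, and only the half-edges of [U] remain to be compared. *)
have -> : ((npairings n)%:R * expR (theta * #|A|%:R) = E0 * n.-2.+1%:R :> R)%R.
  by rewrite /E0 -{1}nn [npairings _.+2]/= natrM; ring.
rewrite cS1 natrD mulrDr mulr_natr lerD2l -mulrA ler_wpM2l // natr_sum.
have Uk : (#|~: U| <= k)%N by rewrite -ltnS (leq_trans _ kj) // addnS ltnS leq_addr.
(* As [U] carries at most [#|H|] half-edges, the drift bound makes the exponential sum at most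
   [1 - c] times the number of half-edges of [U], and [z] cancels [1 - c]. *)
have sumU : ((\sum_(w in U) (deg w)%:R : R) <= #|H|%:R)%R.
  by rewrite -natr_sum -card_halves ler_nat max_card.
have dr := drift Uk.
rewrite (eq_bigr (fun w =>
  (deg w)%:R * expR (theta * ((deg w)%:R - 2)) - (deg w)%:R)%R) in dr; last first.
  by move=> w _; rewrite mulrBr mulr1.
rewrite sumrB in dr; rewrite /z ler_pdivrMl ?subr_gt0 //.
have := ler_wpM2l c_ge0 sumU; lra.
Qed.

End Exploration.

(** * From the exploration to the largest component of the configuration model *)

Section ComponentTail.
Import mathcomp.boot.finset mathcomp.boot.fintype mathcomp.boot.fingraph.
Local Open Scope set_scope.
Variables (R : realType) (n : nat) (d : 'I_n -> nat).
Local Notation H := (half_edge d).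

Lemma deg_half_edge w : deg (tag : H -> 'I_n) w = d w.
Proof.
have tag_inj : injective (fun x : 'I_(d w) => Tagged (fun i => 'I_(d i)) x).
  by move=> x y /eqP; rewrite eq_Tagged => /eqP.
rewrite -[RHS]card_ord -(card_imset _ tag_inj); apply: eq_card => -[i x].
rewrite !inE; apply/eqP/imsetP => [/= iw|[y _ ->] //].
by subst i; exists x.
Qed.

Lemma card_half_edge : #|H| = total_degree d.
Proof.
by rewrite card_tagged sumnE big_map big_enum; apply: eq_bigr => i _; rewrite card_ord.
Qed.

Lemma card_pairing : #|pairing d| = npairings (total_degree d).
Proof.
rewrite card_sub -card_half_edge -[#|H|]cardsT -card_pairing_on.
by apply: eq_card => M; rewrite !inE.
Qed.

(** Defined for any set of blocks, so that the component becomes a map [C] of the kind explored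
    above. *)
Definition linked (M : {set {set H}}) : rel 'I_n :=
  fun u w => [exists B in M, tag @: B == [set u; w]].

Lemma adjacent_linked (M : pairing d) :
  Defs.adjacent (configuration_multigraph M) =2 linked (val M).
Proof.
move=> u w; apply/existsP/existsP => [[e /eqP ee]|[B /andP[BM /eqP EB]]].
  by exists (val e); rewrite (valP e) /= -ee; apply/eqP/setP => x; apply/imsetP/imsetP.
by exists (exist _ B BM); rewrite -EB; apply/eqP/setP => x; apply/imsetP/imsetP.
Qed.

Lemma linked_sym M : symmetric (linked M).
Proof. by move=> u w; rewrite /linked setUC. Qed.

Definition component M v : {set 'I_n} := [set u | connect (linked M) v u].

Lemma component_closed v (U : {set 'I_n}) (M : {set {set H}}) : v \notin U ->
  (forall B, B \in M -> B \subset halves tag U \/ B \subset halves tag (~: U)) ->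
  component M v :&: U = set0.
Proof.
move=> vU hM; apply/setP => x; rewrite !inE; apply/negP => /andP[vx xU].
have cl : closed (linked M) U.
  move=> u w /existsP[B /andP[BM /eqP EB]].
  have mB y : y \in [set u; w] -> exists2 b, b \in B & y = tag b.
    by rewrite -EB => /imsetP[b]; exists b.
  have [b bB ->] := mB u (set21 _ _); have [b' bB' ->] := mB w (set22 _ _).
  have [/subsetP BU|/subsetP BU] := hM _ BM.
    by have := BU _ bB; have := BU _ bB'; rewrite !inE => -> ->.
  by have := BU _ bB; have := BU _ bB'; rewrite !inE => /negPf-> /negPf->.
by rewrite (closed_connect cl vx) xU in vU.
Qed.

Lemma card_adjacent_component (M : pairing d) v :
  #|connect (Defs.adjacent (configuration_multigraph M)) v| = #|component (val M) v|.
Proof.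
apply: eq_card => u; rewrite [RHS]inE -topredE /=.
exact: (eq_connect (adjacent_linked M)).
Qed.

(** Every vertex of a component with more than [j] vertices is counted on the right, so one such
    component already contributes [j + 1]. *)
Lemma L1_size_bias (M : pairing d) j :
  ((j < L1 (configuration_multigraph M))%N * j.+1 <=
   \sum_v (j < #|component (val M) v|))%N.
Proof.
case: ltnP => [jL|_]; last by rewrite mul0n.
have [v jv] : exists v, (j < #|component (val M) v|)%N.
  apply/existsP; apply: contraLR jL => /existsPn h; rewrite -leqNgt.
  by apply/bigmax_leqP => v _; rewrite card_adjacent_component leqNgt h.
rewrite mul1n (leq_trans jv) // -sum1_card big_mkcond /=.
apply: leq_sum => u _; case: ifP => //; rewrite inE => vu.
have -> : component (val M) u = component (val M) v; last by rewrite jv.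
apply/setP => w; rewrite !inE; apply/esym/same_connect => //.
exact/sym_connect_sym/linked_sym.
Qed.

Variables (theta c : R) (j : nat).
Hypothesis theta_ge0 : (0 <= theta)%R.
Hypotheses (c_ge0 : (0 <= c)%R) (c_lt1 : (c < 1)%R).
Hypothesis drift : forall U : {set 'I_n}, (#|~: U| <= j)%N ->
  (\sum_(w in U) (d w)%:R * (expR (theta * ((d w)%:R - 2)) - 1)
    <= - (c * (total_degree d)%:R))%R.

Let z : R := ((1 - c)^-1)%R.

(** The exploration starts with the half-edges of [v] active and all other vertices unexplored. The
    [- 1] appears on both sides because pairings outside the event also contribute at least 1 each
    to the explored sum. *)
Lemma component_tail v :
  (#|[pred M : pairing d | (j < #|component (val M) v|)%N]|%:R * (z ^+ j - 1)
    <= #|pairing d|%:R * (expR (theta * (d v)%:R) - 1))%R.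
Proof.
have z_ge1 : (1 <= z)%R by rewrite /z invf_ge1 ?subr_gt0 // gerBl.
have drift' (U : {set 'I_n}) : (#|~: U| <= j)%N ->
    (\sum_(w in U) (deg (tag : H -> 'I_n) w)%:R *
        (expR (theta * ((deg (tag : H -> 'I_n) w)%:R - 2)) - 1)
      <= - (c * #|H|%:R))%R.
  by move=> /drift; rewrite card_half_edge; under eq_bigr do rewrite -deg_half_edge.
have := exploration_bound (@component_closed v) theta_ge0 c_ge0 c_lt1 drift'
   (j := j) (A := halves tag [set v]) (U := ~: [set v]) (M0 := set0).
rewrite !inE eqxx setCK subxx cards1 add1n => /(_ isT isT _ (leqnn _)).
have -> : halves tag [set v] :|: halves tag (~: [set v]) = [set: H].
  by apply/setP => x; rewrite !inE orbN.
rewrite cardsT card_half_edge -card_pairing -/(deg tag v) deg_half_edge => bd.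
have {bd} := bd (fun B => ltac:(by rewrite inE)).
move=> bd; rewrite [leRHS]mulrBr mulr1 lerBrDr; apply: le_trans bd.
have -> : (#|pairing d|%:R = \sum_(M : pairing d) 1 :> R)%R by rewrite sumr_const.
rewrite -sum1_card natr_sum mulr_suml big_mkcond -big_split /=.
rewrite [leRHS](reindex_omap (val : pairing d -> _) insub) => [|M PM]; last by rewrite insubT.
rewrite [leRHS](eq_bigl xpredT) => [|M]; last by rewrite valK eqxx andbT; exact: (valP M).
apply: ler_sum => M _; rewrite set0U; case: ifP => [|_]; last first.
  by rewrite add0r exprn_ege1.
(* Without [v] itself the component still has at least [j] vertices, so the exponent is exactly
   [j]. *)
rewrite inE (cardsD1 v) inE connect0 add1n ltnS mul1r subrK => jC.
rewrite ler_weXn2l // leq_min leqnn andbT (leq_trans jC) // subset_leq_card //.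
by apply/subsetP => x; rewrite !inE andbC.
Qed.

(** Markov's inequality for the number of vertices whose component has more than [j] vertices: this
    number is at least [j + 1] unless it is 0. *)
Lemma L1_tail :
  ((j.+1%:R * (z ^+ j - 1)) *
     #|[pred M : pairing d | (j < L1 (configuration_multigraph M))%N]|%:R
   <= #|pairing d|%:R * \sum_v (expR (theta * (d v)%:R) - 1))%R.
Proof.
have z_ge1 : (1 <= z)%R by rewrite /z invf_ge1 ?subr_gt0 // gerBl.
have dc : (#|[pred M : pairing d | (j < L1 (configuration_multigraph M))%N]| * j.+1
    <= \sum_v #|[pred M : pairing d | (j < #|component (val M) v|)%N]|)%N.
  rewrite -sum1_card big_mkcond big_distrl /=.
  under [leqRHS]eq_bigr do rewrite -sum1_card big_mkcond.
  rewrite exchange_big; apply: leq_sum => M _.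
  apply: leq_trans (L1_size_bias M j) _; exact: leqnn.
rewrite mulr_sumr mulrAC -natrM mulnC.
apply: le_trans (ler_wpM2r _ (_ : _%:R <=
  (\sum_v #|[pred M : pairing d | (j < #|component (val M) v|)%N]|)%N%:R)%R) _.
- by rewrite subr_ge0 exprn_ege1.
- by rewrite ler_nat.
rewrite natr_sum mulr_suml; apply: ler_sum => v _; exact: component_tail.
Qed.

End ComponentTail.

(** * Elementary bounds on the exponential *)

Section ExpBounds.
Variable R : realType.
Implicit Types x y eta : R.

Lemma expR_mul_le1 y : expR y * (1 - y) <= 1.
Proof.
rewrite -ler_pdivlMl ?expR_gt0 // mulr1 -expRN.
exact: expR_ge1Dx.
Qed.

(** The right side minus the left one vanishes at 0, and its derivative is nonnegative on
    [[0, eta / 2]] and nonpositive on the negative side. *)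
Lemma expR_le_quadratic eta y : 0 < eta <= 1 -> `|y| <= eta / 2 ->
  expR y <= 1 + y + (1 + eta) / 2 * y ^+ 2.
Proof.
move=> /andP[eta0 eta1] ye.
pose f x : R := 1 + x + (1 + eta) / 2 * x ^+ 2 - expR x.
have df (x : R) : is_derive x 1 f (1 + (1 + eta) * x - expR x).
  by apply: is_derive_eq; rewrite /GRing.scale /=; field.
have cf : continuous f.
  by move=> x; apply/differentiable_continuous/derivable1_diffP; apply: ex_derive.
have f'E x : derive1 f x = 1 + (1 + eta) * x - expR x by rewrite derive1E derive_val.
suff : f 0 <= f y by rewrite /f expR0 expr0n /=; lra.
have [y0|y0] := leP 0 y.
- apply: (@ger0_derive1_le_cc _ f 0 (eta / 2)) => //.
  + move=> x; rewrite in_itv /= => /andP[x0 xe]; rewrite f'E subr_ge0.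
    (* After multiplication by [1 - x], it suffices that [(1 - x) (1 + (1 + eta) x) >= 1], which
       holds for [0 <= x <= eta / 2] and [eta <= 1]. *)
    have x1 : 0 < 1 - x by lra.
    rewrite -(ler_pM2r x1); apply: le_trans (expR_mul_le1 x) _; nra.
  + exact: continuous_subspaceT.
  + by rewrite in_itv /= lexx; lra.
  + by rewrite in_itv /= y0 /= (le_trans (ler_norm _)).
- apply: (@ler0_derive1_le_cc _ f y 0) => //.
  + move=> x; rewrite in_itv /= => /andP[x0 xe]; rewrite f'E.
    have := expR_ge1Dx x; nra.
  + exact: continuous_subspaceT.
  + by rewrite in_itv /= lexx ltW.
  + by rewrite in_itv /= lexx ltW.
  + exact: ltW.
Qed.

End ExpBounds.

(** * Degree sums controlling the drift and the starting cost of the exploration *)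

Section Subcritical.
Variables (R : realType) (n : nat) (d : 'I_n -> nat).
Hypothesis d_gt0 : forall i, (0 < d i)%N.
Local Notation m := (total_degree d).
Local Notation Q := (Qn R d).
Local Notation S := (Rn R d).

Lemma total_degree_ge : (n <= m)%N.
Proof.
rewrite -[leqLHS]card_ord -sum1_card; apply: leq_sum => i _; exact: d_gt0.
Qed.

Lemma mul_degree_Qn : m%:R * Q = \sum_i (d i)%:R * ((d i)%:R - 2).
Proof.
have [m0|m0] := eqVneq m 0%N; last by rewrite /Qn mulrA mulfV ?mul1r // pnatr_eq0.
rewrite m0 mul0r big1 // => i _; have := d_gt0 i.
by rewrite lt0n -leqn0 -m0 /total_degree (bigD1 i) //= leq_addr.
Qed.

Lemma mul_degree_Rn : m%:R * S = \sum_i (d i)%:R * ((d i)%:R - 2) ^+ 2.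
Proof.
have [m0|m0] := eqVneq m 0%N; last by rewrite /Rn mulrA mulfV ?mul1r // pnatr_eq0.
rewrite m0 mul0r big1 // => i _; have := d_gt0 i.
by rewrite lt0n -leqn0 -m0 /total_degree (bigD1 i) //= leq_addr.
Qed.

Lemma Rn_ge0 : 0 <= S.
Proof.
by rewrite mulr_ge0 ?invr_ge0 ?ler0n // sumr_ge0 // => i _; rewrite mulr_ge0 ?ler0n ?sqr_ge0.
Qed.

(* Since (d - 1) (d - 2) >= 0, the average of d - 2 is at most Q. *)
Lemma total_degree_le : Q <= 0 -> m%:R <= 2 * n%:R :> R.
Proof.
move=> Q0; have : \sum_i ((d i)%:R - 2) <= m%:R * Q.
  rewrite mul_degree_Qn; apply: ler_sum => i _.
  have [d1|] := ltnP (d i) 2.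
    have -> : d i = 1%N by apply/eqP; rewrite eqn_leq -ltnS d1 d_gt0.
    by lra.
  by rewrite -(ler_nat R) => ?; nra.
rewrite sumrB sumr_const card_ord -natr_sum -/m -[2 *+ n]mulr_natr => h.
have mQ0 : m%:R * Q <= 0 by rewrite mulr_ge0_le0 ?ler0n.
lra.
Qed.

(** The quadratic expansion is summed over all vertices. Taking out an explored vertex then costs at
    most [theta]: its term is nonnegative for degree at least 2, and at least [- theta] for degree
    1. *)
Lemma drift_bound (eta theta : R) (U : {set 'I_n}) :
  0 < eta <= 1 -> 0 <= theta -> theta * (max_degree d)%:R <= eta / 2 ->
  \sum_(w in U) (d w)%:R * (expR (theta * ((d w)%:R - 2)) - 1) <=
  m%:R * (theta * Q + (1 + eta) / 2 * theta ^+ 2 * S) + #|(~: U)%SET|%:R * theta.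
Proof.
move=> eta01 theta0 th.
pose F w : R := (d w)%:R * (expR (theta * ((d w)%:R - 2)) - 1).
have -> : \sum_(w in U) F w = \sum_w F w - \sum_(w in (~: U)%SET) F w.
  rewrite [X in X - _](bigID (mem U)) /= [X in _ + X - _](eq_bigl (mem (~: U)%SET)).
    by rewrite addrK.
  by move=> w; rewrite !inE.
rewrite lerD //.
  rewrite mulrDr mulrCA mul_degree_Qn mulrCA mul_degree_Rn !mulr_sumr -big_split /=.
  apply: ler_sum => w _.
  have dD : ((d w)%:R <= (max_degree d)%:R :> R) by rewrite ler_nat; exact: leq_bigmax.
  have d1 : (1 <= (d w)%:R :> R) by rewrite ler1n.
  have : `|theta * ((d w)%:R - 2)| <= eta / 2.
    apply: le_trans th; rewrite normrM ger0_norm // ler_wpM2l // ler_norml; lra.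
  move=> /(expR_le_quadratic eta01) => h.
  rewrite /F.
  have := ler_wpM2l (ler0n R (d w)) (h); lra.
rewrite -sumrN mulr_natl -sumr_const; apply: ler_sum => w _; rewrite /F.
have [d1|] := ltnP (d w) 2.
  have -> : d w = 1%N by apply/eqP; rewrite eqn_leq -ltnS d1 d_gt0.
  have := expR_ge1Dx (theta * (1%:R - 2)); lra.
rewrite -(ler_nat R) => d2.
have : 1 <= expR (theta * ((d w)%:R - 2)).
  by rewrite -[leLHS](expR0 R) ler_expR mulr_ge0 // subr_ge0.
have d0 := ler0n R (d w); nra.
Qed.

(** For [0 <= y <= 1 / 2] one has [(1 + 2 y) (1 - y) >= 1], hence [expR y <= 1 + 2 y]. *)
Lemma total_degree_exp_bound (theta : R) : 0 <= theta ->
  theta * (max_degree d)%:R <= 1 / 2 ->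
  \sum_v (expR (theta * (d v)%:R) - 1) <= 2 * theta * m%:R.
Proof.
move=> theta0 th; rewrite /total_degree natr_sum mulr_sumr; apply: ler_sum => v _.
have dD : ((d v)%:R <= (max_degree d)%:R :> R) by rewrite ler_nat; exact: leq_bigmax.
have yle := le_trans (ler_wpM2l theta0 dD) th.
have y0 : 0 <= theta * (d v)%:R by rewrite mulr_ge0.
rewrite -mulrA; set y := theta * _ in yle y0 *.
have y1 : 0 < 1 - y by lra.
suff : expR y <= 1 + 2 * y by lra.
by rewrite -(ler_pM2r y1); apply: le_trans (expR_mul_le1 y) _; nra.
Qed.

End Subcritical.

(** * The tail bound at fixed [n] *)

Section UpperBound.
Variables (R : realType) (n : nat) (d : 'I_n -> nat).
Hypothesis d_gt0 : forall i, (0 < d i)%N.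
Local Notation m := (total_degree d).
Local Notation Q := (Qn R d).
Local Notation S := (Rn R d).

Lemma CM_pr_complement (P : pred (multigraph 'I_n)) : ~~ odd m ->
  CM_pr R d P + CM_pr R d (predC P) = 1.
Proof.
move=> mev; rewrite /CM_pr /uniform_pr -mulrDl -natrD.
have -> : (#|[pred M : pairing d | P (configuration_multigraph M)]| +
   #|[pred M : pairing d | predC P (configuration_multigraph M)]|)%N = #|pairing d|.
  by rewrite -(cardC [pred M : pairing d | P (configuration_multigraph M)]).
by rewrite mulfV // pnatr_eq0 -lt0n card_pairing npairings_gt0.
Qed.

(** The non-asymptotic core; its error term vanishes as [ell] grows. The value of [eta] gives
    [(1 + eps) (1 - 2 eta) = 1 + eps / 2]. *)
Lemma CM_L1_upper (eps : R) :
  let eta := eps / (4 * (1 + eps)) in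
  let ell := ln (`|Q| ^+ 3 * n%:R / S ^+ 2) in
  let K := (1 + eps) * (2 * S / Q ^+ 2) * ell in
  0 < eps -> ~~ odd m -> (0 < n)%N -> Q < 0 -> 0 < S -> Q ^+ 2 <= S ->
  (max_degree d)%:R * `|Q| <= eta / 2 * S ->
  1 <= ell -> 1 <= eps / 2 * ell -> K <= eta / 2 * (n%:R * `|Q|) ->
  1 - 4 * expR (1 - eps / 2 * ell) <= CM_pr R d (fun G => (L1 G)%:R <= K).
Proof.
move=> eta ell K eps0 mev n0 Q0 S0 QS DQ ell1 ell2 Kn.
have qE : `|Q| = - Q by rewrite ltr0_norm.
pose q := - Q; rewrite qE -/q in DQ Kn *.
have q0 : 0 < q by rewrite oppr_gt0.
have QE : Q = - q by rewrite opprK.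
have n0' : 0 < n%:R :> R by rewrite ltr0n.
pose L : R := q ^+ 3 * n%:R / S ^+ 2.
have L0 : 0 < L.
  by apply: divr_gt0; [apply: mulr_gt0 => //; exact: exprn_gt0|exact: exprn_gt0].
have ellE : expR ell = L by rewrite /ell qE -/q lnK.
have etaE : eta = eps / (4 * (1 + eps)) by [].
have eta0 : 0 < eta by rewrite divr_gt0 ?mulr_gt0 //; lra.
have eta14 : eta <= 1 / 4.
  by rewrite etaE ler_pdivrMr; lra.
have KE : K = (1 + eps) * (2 * S / q ^+ 2) * ell by rewrite /K /q sqrrN.
have qS : q ^+ 2 <= S by rewrite /q sqrrN.
have LE : L = q ^+ 3 * n%:R / S ^+ 2 by [].
clearbody K ell eta L q.
have q2 : 0 < q ^+ 2 by exact: exprn_gt0.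
have Sq : 0 < 2 * S / q ^+ 2 by apply: divr_gt0 => //; apply: mulr_gt0.
have K0 : 0 < K by rewrite KE; do 2?apply: mulr_gt0 => //; lra.
pose j := Num.truncn K.
have /andP[jK Kj] := truncn_itv (ltW K0).
(* Minimises [theta * Q + theta ^+ 2 * S / 2], with minimum [- q ^+ 2 / (2 * S)]. *)
pose theta : R := q / S.
have theta0 : 0 < theta by rewrite divr_gt0.
(* One [eta] is lost to the quadratic expansion, the other to the explored vertices. *)
pose c : R := (1 - 2 * eta) * (q ^+ 2 / (2 * S)).
have cE : c = (1 - 2 * eta) * (q ^+ 2 / (2 * S)) by [].
have c0 : 0 <= c by apply: mulr_ge0; [lra|apply: divr_ge0; lra].
have r1 : q ^+ 2 / (2 * S) <= 1 / 2 by rewrite ler_pdivrMr; lra.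
have r0 : 0 <= q ^+ 2 / (2 * S) by apply: divr_ge0; lra.
have c1 : c < 1 by rewrite /c; nra.
have thetaE : theta = q / S by [].
clearbody c theta.
have nm : n%:R <= m%:R :> R by rewrite ler_nat total_degree_ge.
have m2n := total_degree_le d_gt0 (ltW Q0).
have thD : theta * (max_degree d)%:R <= eta / 2.
  by rewrite thetaE mulrAC ler_pdivrMr // mulrC.
have drift (U : {set 'I_n}) : (#|(~: U)%SET| <= j)%N ->
    \sum_(w in U) (d w)%:R * (expR (theta * ((d w)%:R - 2)) - 1) <= - (c * m%:R).
  move=> Uj; have eta01 : 0 < eta <= 1 by apply/andP; split=> //; lra.
  apply: le_trans (drift_bound d_gt0 U eta01 (ltW theta0) thD) _.
  have Utheta : #|(~: U)%SET|%:R * theta <= eta / 2 * (m%:R * (q ^+ 2 / S)).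
    apply: le_trans (_ : eta / 2 * (n%:R * q) * theta <= _).
      apply: ler_wpM2r (ltW theta0) _ _ _; apply: le_trans Kn; apply: le_trans jK.
      by rewrite ler_nat.
    have -> : eta / 2 * (n%:R * q) * theta = eta / 2 * (n%:R * (q ^+ 2 / S)).
      by rewrite thetaE; field; exact: lt0r_neq0.
    by rewrite ler_wpM2l ?ler_wpM2r //; [lra|apply: divr_ge0; lra].
  have E1 : theta * Q + (1 + eta) / 2 * theta ^+ 2 * S = - (1 - eta) / 2 * (q ^+ 2 / S).
    by rewrite QE thetaE; field; exact: lt0r_neq0.
  have -> : c * m%:R = (1 - 2 * eta) / 2 * (m%:R * (q ^+ 2 / S)).
    by rewrite cE; field; exact: lt0r_neq0.
  rewrite E1; lra.
have th2 : theta * (max_degree d)%:R <= 1 / 2 by lra.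
pose z := (1 - c)^-1.
(* Here [z >= expR c] and [c * K = (1 + eps / 2) * ell]; rounding [K] down to [j] costs at most
   [c < 1] in the exponent. *)
have zj : expR (ell + eps / 2 * ell - 1) <= z ^+ j.
  have cK : c * K = ell + eps / 2 * ell.
    have e1 : 1 + eps != 0 by apply: lt0r_neq0; lra.
    by rewrite KE cE etaE; field; rewrite e1 !lt0r_neq0.
  apply: le_trans (_ : expR c ^+ j <= _).
    rewrite -expRM_natr ler_expR -cK; have : c * K <= c * j.+1%:R by rewrite ler_wpM2l // ltW.
    rewrite -natr1; lra.
  apply: lerXn2r; rewrite ?nnegrE ?expR_ge0 ?invr_ge0; [lra..|].
  rewrite /z -[leLHS]invrK lef_pV2 ?posrE ?invr_gt0 ?expR_gt0; [|lra..].
  by rewrite -expRN; exact: expR_ge1Dx.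
pose W := expR (ell + eps / 2 * ell - 1).
(* Allows [W - 1] to be replaced by [W / 2]. *)
have W2 : 2 <= W by apply: le_trans (expR_ge1Dx _); lra.
pose Y := expR (eps / 2 * ell - 1).
have Y0 : 0 < Y by exact: expR_gt0.
have WE : W = L * Y by rewrite /W -addrA expRD ellE.
have tn0 : 0 < theta * n%:R by exact: mulr_gt0.
(* Since [(2 * S / q ^+ 2) * L = 2 * theta * n], the factor [L] of [W] cancels the starting cost
   [4 * theta * n], and the bad event is left with probability at most [4 / Y]. *)
have KL : 2 * (theta * n%:R) <= K * L.
  have -> : 2 * (theta * n%:R) = (2 * S / q ^+ 2) * L.
    by rewrite thetaE LE; field; rewrite !lt0r_neq0.
  have e1 : 1 <= (1 + eps) * ell by have := mulr_gt0 eps0 (lt_le_trans ltr01 ell1); lra.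
  by rewrite ler_wpM2r ?(ltW L0) // KE [leRHS]mulrAC ler_peMl // ltW.
have KW0 : 0 <= W / 2 <= z ^+ j - 1.
  rewrite -/W in zj; clear - zj W2; apply/andP; split; lra.
have tm : 2 * theta * m%:R <= 4 * (theta * n%:R).
  by have := ler_wpM2l (ltW theta0) m2n; lra.
have := L1_tail (ltW theta0) c0 c1 drift.
rewrite -/z; set bad := #|_|%:R => tail.
have badE : CM_pr R d (predC (fun G => (L1 G)%:R <= K)) = bad / #|pairing d|%:R.
  rewrite /CM_pr /uniform_pr; congr (_%:R / _); apply: eq_card => M.
  by rewrite !inE /= -ltNge -truncn_lt_nat // ltW.
have := CM_pr_complement (fun G => (L1 G)%:R <= K) mev; rewrite badE.
set b := bad / _ => /(canRL (addrK _)) ->.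
have P0 : 0 < #|pairing d|%:R :> R by rewrite ltr0n card_pairing npairings_gt0.
have b0 : 0 <= b by rewrite divr_ge0.
have Db : j.+1%:R * (z ^+ j - 1) * b <= 4 * (theta * n%:R).
  apply: le_trans tm.
  apply: le_trans (total_degree_exp_bound (ltW theta0) th2).
  by rewrite /b mulrA ler_pdivrMr // mulrC [leRHS]mulrC mulrC.
have {}Db : K * (W / 2) * b <= 4 * (theta * n%:R).
  case/andP: KW0 => W0 Wz; apply: le_trans Db; apply: ler_wpM2r => //.
  by apply: ler_pM => //; exact: ltW.
rewrite lerB // -[expR _]invrK -expRN opprB -/Y ler_pdivlMr //.
have {}Db : (K * L) * (b * Y / 2) <= 4 * (theta * n%:R).
  by apply: le_trans Db; rewrite WE le_eqVlt; apply/orP; left; apply/eqP; field.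
have bY : 0 <= b * Y / 2 by rewrite divr_ge0 ?mulr_ge0 // ltW.
have := le_trans (ler_wpM2r bY KL) Db.
have -> : 2 * (theta * n%:R) * (b * Y / 2) = b * Y * (theta * n%:R) by field.
by rewrite ler_pM2r.
Qed.

End UpperBound.

(** * A lower bound on [Rn] from the limit law *)

Lemma probability_eq_on (R : realType) (disp : measure_display)
    (T : measurableType disp) (mu : probability T R) (N A B : set T) :
  measurable N -> measurable A -> measurable B ->
  mu N = 1%E -> A `&` N = B `&` N -> mu A = mu B.
Proof.
move=> mN mA mB N1 AB.
have muI E : measurable E -> mu E = mu (E `&` N).
  move=> mE; rewrite (measureDI mu mE mN).
  have N0 : mu (~` N) = 0%E by rewrite probability_setC // N1 subee.
  rewrite (subset_measure0 (B := ~` N)) ?add0e //.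
  - exact: measurableD.
  - exact: measurableC.
by rewrite (muI _ mA) (muI _ mB) AB.
Qed.

Section IntegerValued.
Variables (R : realType) (disp : measure_display) (T : measurableType disp).
Variables (P : probability T R) (D : {RV P >-> R}).
Hypothesis D_nat : P (D @^-1` range (fun k : nat => k%:R)) = 1%E.

Let N : set R := range (fun k : nat => k%:R).

Let mN : measurable N.
Proof.
apply: countable_measurable; first by move=> t; exact: measurable_set1.
exact: card_image_le.
Qed.

Let law_eq (A B : set R) : measurable A -> measurable B -> A `&` N = B `&` N ->
  distribution P D A = distribution P D B.
Proof. by move=> mA mB; apply: probability_eq_on. Qed.

(** An integer-valued variable has a distribution function constant between consecutive integers.
    Half-integers are thus points where convergence in law applies. *)
Lemma cdf_continuous_natr_half (k : nat) :
  {for (k%:R + 1 / 2 : R), continuous (cdf D)}.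
Proof.
apply: cvg_near_cst.
near=> y.
have : y \in `]k%:R, k%:R + 1[ by near: y; apply: near_in_itvoo; rewrite in_itv /=; lra.
rewrite in_itv /= => /andP[ky yk].
apply: law_eq => //; apply/seteqP.
split=> x [/= + [j _ jx]]; rewrite -jx !in_itv /= => h; split; try by exists j.
  have : (j <= k)%N by rewrite -ltnS -(ltr_nat R) -natr1; lra.
  rewrite -(ler_nat R); lra.
have : (j <= k)%N by rewrite -ltnS -(ltr_nat R) -natr1; lra.
rewrite -(ler_nat R); lra.
Unshelve. all: by end_near.
Qed.

(** The increase of the distribution function from 3/2 to 5/2 is at most [P (D = 2)], and this plus
    the mass outside [{0, 2}] is at most 1. *)
Lemma cdf_jump_at_two :
  (cdf D (2 + 1 / 2) + P (D @^-1` ~` [set 0%R; 2%R]) <= cdf D (1 + 1 / 2) + 1)%E.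
Proof.
have m2 : measurable [set 2 : R] by exact: measurable_set1.
have -> : cdf D (2 + 1 / 2) = distribution P D (`]-oo, (1 + 1 / 2)] `|` [set 2]).
  apply: law_eq => //; first exact: measurableU.
  apply/seteqP; split=> x [/= + [j _ jx]]; rewrite -jx /= !in_itv /= => h; split; try by exists j.
    have : (j <= 2)%N by rewrite -ltnS -(ltr_nat R) -natr1; lra.
    rewrite leq_eqVlt => /orP[/eqP ->|]; first by right.
    rewrite ltnS -(ler_nat R) => j1; left; lra.
  by case: h => [|->]; lra.
apply: le_trans (leeD2r _ (measureU2 _ _ _)) _ => //.
rewrite -addeA leeD2l //.
have <- : (distribution P D [set 2%R] + distribution P D (~` [set 2%R]) = 1)%E.
  by rewrite probability_setC // addeCA subee ?adde0 // fin_num_measure.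
rewrite leeD2l // le_measure ?inE //.
- by apply: measurable_funPTI; apply: measurableC; exact: measurableU.
- by apply: measurable_funPTI; exact: measurableC.
- by move=> x /= /not_orP[].
Qed.

End IntegerValued.

(** A vertex of degree other than 2 adds at least 1 to [m * Rn], and [m <= 2 n] when [Qn <= 0]. *)
Lemma Rn_ge_uniform_pr (R : realType) (n : nat) (d : 'I_n -> nat) :
  (forall i, (0 < d i)%N) -> (0 < n)%N -> Qn R d <= 0 ->
  uniform_pr R [pred i | d i != 2%N] / 2 <= Rn R d.
Proof.
move=> d_gt0 n0 Q0; have n0' : 0 < n%:R :> R by rewrite ltr0n.
have nm : n%:R <= (total_degree d)%:R :> R by rewrite ler_nat total_degree_ge.
have m0 : 0 < (total_degree d)%:R :> R by apply: lt_le_trans nm.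
have m2n := total_degree_le d_gt0 Q0.
have count : #|[pred i | d i != 2%N]|%:R <= (total_degree d)%:R * Rn R d.
  rewrite (mul_degree_Rn R d_gt0) -sum1_card natr_sum big_mkcond.
  apply: ler_sum => i _; case: ifP => /= [/[!inE] d2|_]; last by rewrite mulr_ge0 ?sqr_ge0.
  have d1 : 1 <= (d i)%:R :> R by rewrite ler1n.
  have : 1 <= ((d i)%:R - 2) ^+ 2 :> R.
    have [d3|d3] := leqP 3 (d i).
      by have d3' : 3%:R <= (d i)%:R :> R; [rewrite ler_nat|rewrite expr2; nra].
    have -> : d i = 1%N by apply/eqP; move: d2 (d_gt0 i) d3; case: (d i) => [|[|[|]]].
    by rewrite expr2; lra.
  move=> h; apply: le_trans h _; rewrite ler_peMl ?sqr_ge0 //.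
rewrite /uniform_pr card_ord ler_pdivrMr // ler_pdivrMr //.
apply: le_trans count _; rewrite mulrC -mulrA ler_wpM2l ?Rn_ge0 //.
Qed.

(** Half-integer cut-offs express the proportion through distribution functions at continuity points
    of the limit. *)
Lemma uniform_pr_neq_two (R : realType) (n : nat) (d : 'I_n -> nat) : (0 < n)%N ->
  uniform_pr R [pred i | d i != 2%N] =
  1 + uniform_pr R [pred i | ((d i)%:R : R) \in `]-oo, 1 + 1 / 2]%classic]
    - uniform_pr R [pred i | ((d i)%:R : R) \in `]-oo, 2 + 1 / 2]%classic].
Proof.
move=> n0; have n0' : (n%:R : R) != 0 by rewrite pnatr_eq0 -lt0n.
have half i (k : nat) : (((d i)%:R : R) \in `]-oo, k%:R + 1 / 2]%classic) = (d i <= k)%N.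
  rewrite mem_setE in_itv /=; apply/idP/idP => [h|].
    by rewrite -ltnS -(ltr_nat R) -natr1; lra.
  by rewrite -(ler_nat R); lra.
apply/eqP; rewrite eq_sym subr_eq /uniform_pr card_ord -{1}(divff n0') -!mulrDl -!natrD.
apply/eqP; congr (_%:R / _).
rewrite -{1}(card_ord n) -!sum1_card.
rewrite [X in (_ + X = _)%N]big_mkcond [X in (_ = X + _)%N]big_mkcond.
rewrite [X in (_ = _ + X)%N]big_mkcond.
rewrite -!big_split; apply: eq_bigr => i _ /=; rewrite !inE.
have := half i 1%N; have := half i 2%N; rewrite /= => -> ->.
by case: (d i) => [|[|[|k]]].
Qed.

Lemma liminf_uniform_pr_neq_two (R : realType) (d : forall n, 'I_n -> nat) :
  assumption_A R d ->
  exists2 c : R, 0 < c & \forall n \near \oo, c <= uniform_pr R [pred i | d n i != 2%N].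
Proof.
move=> [disp [T [P [D [D_nat cvD [_ pos _ _]]]]]].
pose X : {RV P >-> R} := D.
have cdf_cvg (k : nat) :
  uniform_pr R [pred i | ((d n i)%:R : R) \in `]-oo, k%:R + 1 / 2]%classic] @[n --> \oo]
    --> fine (cdf X (k%:R + 1 / 2)).
  have := cvD _ (cdf_continuous_natr_half (D := X) D_nat (k := k)).
  rewrite -[cdf (_ : {RV P >-> R}) _]fineK ?fin_num_measure // => h; exact: (fine_cvg h).
pose delta := fine (P (X @^-1` ~` [set 0%R; 2%R])).
have Pfin : P (X @^-1` ~` [set 0%R; 2%R]) \is a fin_num.
  by apply: fin_num_measure; apply: measurable_funPTI; apply: measurableC; exact: measurableU.
have delta0 : 0 < delta by rewrite fine_gt0 // pos /= ltey_eq Pfin.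
have jump := cdf_jump_at_two (D := X) D_nat.
exists (delta / 2); first by rewrite divr_gt0.
have lim : 1 + uniform_pr R [pred i | ((d n i)%:R : R) \in `]-oo, 1%:R + 1 / 2]%classic]
    - uniform_pr R [pred i | ((d n i)%:R : R) \in `]-oo, 2%:R + 1 / 2]%classic] @[n --> \oo]
    --> 1 + fine (cdf X (1%:R + 1 / 2)) - fine (cdf X (2%:R + 1 / 2)).
  by apply: cvgB => //; apply: cvgD => //; exact: cvg_cst.
have lim_gt : delta / 2 < 1 + fine (cdf X (1%:R + 1 / 2)) - fine (cdf X (2%:R + 1 / 2)).
  move: jump; rewrite -[cdf X (2 + _)]fineK ?fin_num_measure //.
  rewrite -[cdf X (1 + _)]fineK ?fin_num_measure //.
  rewrite -[P _]fineK // -!EFinD lee_fin -/delta => h; move: (h); lra.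
near=> n.
rewrite uniform_pr_neq_two; last by near: n; exists 1%N.
by near: n; apply: (cvgr_ge _ lim).
Unshelve. all: by end_near.
Qed.

(** * Asymptotics of the parameters and conclusion *)

Lemma ln_ratio_ge (R : realType) (n : nat) (A w Q S : R) :
  (0 < n)%N -> 0 < S -> 1 <= w -> expR A <= w ->
  Q <= - (w * n%:R `^ (- (1 / 3)) * S `^ (2 / 3)) ->
  A <= ln (`|Q| ^+ 3 * n%:R / S ^+ 2).
Proof.
move=> n0 S0 w1 Aw QS; have n0' : 0 < n%:R :> R by rewrite ltr0n.
have w0 : 0 < w by apply: lt_le_trans w1.
set B := _ `^ _ in QS; set C := _ `^ _ in QS.
have B0 : 0 < B by exact: powR_gt0.
have C0 : 0 < C by exact: powR_gt0.
have B3 : B ^+ 3 = n%:R^-1.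
  rewrite -powR_mulrn ?powR_ge0 // -powRrM -[RHS]powR_inv1 ?ler0n //.
  by congr powR; field.
have C3 : C ^+ 3 = S ^+ 2.
  rewrite -powR_mulrn ?powR_ge0 // -powRrM -[RHS]powR_mulrn ?(ltW S0) //.
  by congr powR; field.
have wBC : w * B * C <= `|Q| by rewrite ler_normr lerNr QS orbT.
have wBC0 : 0 <= w * B * C by rewrite !mulr_ge0 // ltW.
(* Cubing clears the fractional powers, and [w ^+ 3 >= w] because [w >= 1]. *)
have : w ^+ 3 <= `|Q| ^+ 3 * n%:R / S ^+ 2.
  rewrite ler_pdivlMr ?exprn_gt0 // -ler_pdivrMr // -B3 -C3 -!exprMn mulrAC.
  by rewrite lerXn2r ?nnegrE.
move=> w3; have wL : w <= `|Q| ^+ 3 * n%:R / S ^+ 2.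
  by apply: le_trans w3; rewrite exprS ler_peMr ?(ltW w0) // exprn_ege1.
rewrite -(expRK A) ler_ln ?posrE ?expR_gt0 //; first exact: le_trans wL.
exact: lt_le_trans wL.
Qed.

(* The explored vertices perturb the drift by at most a constant times
   [K / (n |Q|)], and this is negligible since [ln L <= L / C] for large [L]. *)
Lemma threshold_le_drift (R : realType) (n : nat) (eps eta c0 Q S : R) :
  let ell := ln (`|Q| ^+ 3 * n%:R / S ^+ 2) in
  0 < eps -> 0 < eta -> 0 < c0 -> c0 <= S -> Q != 0 -> (0 < n)%N -> 0 <= ell ->
  8 * (1 + eps) <= eta * c0 * ell ->
  (1 + eps) * (2 * S / Q ^+ 2) * ell <= eta / 2 * (n%:R * `|Q|).
Proof.
move=> ell eps0 eta0 c00 cS Q0 n0 ell0 h.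
have S0 : 0 < S by apply: lt_le_trans cS.
have q0 : 0 < `|Q| by rewrite normr_gt0.
have n0' : 0 < n%:R :> R by rewrite ltr0n.
rewrite -(real_normK (num_real Q)); set q := `|Q| in q0 *.
have L0 : 0 < q ^+ 3 * n%:R / S ^+ 2.
  by apply: divr_gt0; [apply: mulr_gt0 => //; exact: exprn_gt0|exact: exprn_gt0].
have ellE : expR ell = q ^+ 3 * n%:R / S ^+ 2 by rewrite lnK.
(* The bound [expR ell >= ell ^+ 2 / 2] leaves a spare factor [ell], which the last hypothesis makes
   large enough. *)
have := expR_ge1Dxn 1 ell0; rewrite ellE; clearbody ell => e2.
have {}e2 : ell ^+ 2 / 2 <= q ^+ 3 * n%:R / S ^+ 2.
  by move: e2; rewrite (_ : 2`! = 2%N) //; lra.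
have q2 : 0 < q ^+ 2 by exact: exprn_gt0.
have -> : (1 + eps) * (2 * S / q ^+ 2) * ell = (2 * S * ((1 + eps) * ell)) / q ^+ 2.
  by field; exact: lt0r_neq0.
rewrite ler_pdivrMr //.
have -> : eta / 2 * (n%:R * q) * q ^+ 2 = eta / 2 * S ^+ 2 * (q ^+ 3 * n%:R / S ^+ 2).
  by field; exact: lt0r_neq0.
apply: le_trans (_ : eta / 2 * S ^+ 2 * (ell ^+ 2 / 2) <= _); last first.
  by rewrite ler_wpM2l // mulr_ge0 ?sqr_ge0 // divr_ge0 // ltW.
have -> : eta / 2 * S ^+ 2 * (ell ^+ 2 / 2) = 2 * S * (eta * S * ell / 8 * ell) by field.
rewrite ler_wpM2l ?ler_wpM2r //; first by rewrite mulr_ge0 // ltW.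
have : eta * c0 * ell <= eta * S * ell by rewrite ler_wpM2r // ler_wpM2l // ltW.
lra.
Qed.

Theorem theorem1p3 (R : realType) (eps : R) (d : forall n : nat, 'I_n -> nat)
    (omega : nat -> R) :
  0 < eps ->
  (forall n, degree_sequence (d n)) ->
  assumption_A R d ->
  (fun n => (max_degree (d n))%:R * `|Qn R (d n)| : R^o)
    =o_\oo (fun n => Rn R (d n) : R^o) ->
  omega n @[n --> \oo] --> +oo ->
  (\forall n \near \oo,
     Qn R (d n) <=
       - (omega n * n%:R `^ (- (1 / 3)) * Rn R (d n) `^ (2 / 3))) ->
  CM_pr R (d n)
    (fun G => (L1 G)%:R <=
       (1 + eps) * (2 * Rn R (d n) / Qn R (d n) ^+ 2) *
       ln (`|Qn R (d n)| ^+ 3 * n%:R / Rn R (d n) ^+ 2))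
    @[n --> \oo] --> (1 : R).
Proof.
move=> eps0 dseq aA DQ omegaoo Qomega.
have [p p0 pn] := liminf_uniform_pr_neq_two aA.
have [_ [_ [_ [_ [_ _ [Qcv _ _ _]]]]]] := aA.
pose eta := eps / (4 * (1 + eps)).
have eta0 : 0 < eta by apply: divr_gt0; lra.
pose ell n := ln (`|Qn R (d n)| ^+ 3 * n%:R / Rn R (d n) ^+ 2).
pose c0 := p / 2.
have c00 : 0 < c0 by exact: divr_gt0.
have npos : \forall n \near \oo, (0 < n)%N by exists 1%N.
have omega1 : \forall n \near \oo, 1 <= omega n by move/cvgryPge : omegaoo; exact.
have Qle0 : \forall n \near \oo, Qn R (d n) <= 0.
  near=> n; apply: le_trans (_ : - (omega n * n%:R `^ (- (1 / 3)) * Rn R (d n) `^ (2 / 3)) <= 0).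
    by near: n.
  rewrite oppr_le0 mulr_ge0 ?powR_ge0 // mulr_ge0 ?powR_ge0 // (le_trans ler01) //.
  by near: n.
have Sge : \forall n \near \oo, c0 <= Rn R (d n).
  near=> n; have [d0 _ _] := dseq n.
  apply: le_trans (Rn_ge_uniform_pr d0 _ _).
  - by rewrite ler_pM2r //; near: n.
  - by near: n.
  - by near: n.
have ell_ge A : \forall n \near \oo, A <= ell n.
  near=> n; apply: (@ln_ratio_ge _ _ _ (omega n)).
  - by near: n.
  - by apply: lt_le_trans c00 _; near: n.
  - by near: n.
  - by near: n; move/cvgryPge : omegaoo; exact.
  - by near: n.
have Q2 : \forall n \near \oo, Qn R (d n) ^+ 2 <= c0.
  (* From [|Q| <= 1] and [|Q| <= c0] follows [Q ^+ 2 <= c0], a lower bound of [Rn]. *)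
  pose r := Num.min 1 c0.
  have r0 : 0 < r by rewrite lt_min ltr01.
  near=> n; have : `|Qn R (d n)| <= r by near: n; exact: cvgr0_norm_le.
  rewrite le_min => /andP[Q1 Qc]; rewrite -(real_normK (num_real _)).
  by apply: le_trans Qc; rewrite expr2 ler_piMr.
have DQ2 : \forall n \near \oo,
    (max_degree (d n))%:R * `|Qn R (d n)| <= eta / 2 * Rn R (d n).
  have e2 : 0 < eta / 2 by exact: divr_gt0.
  have /eqoP /(_ _ e2) DQ' := DQ.
  near=> n; have : `|(max_degree (d n))%:R * `|Qn R (d n)| | <= eta / 2 * `|Rn R (d n)|.
    by near: n.
  by rewrite (ger0_norm (Rn_ge0 _ _)) => /(le_trans (ler_norm _)).
apply/cvgrPdist_le => e e0; near=> n.
have [d0 _ mev] := dseq n.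
have n0 : (0 < n)%N by near: n.
have Sc : c0 <= Rn R (d n) by near: n.
have S0 : 0 < Rn R (d n) by apply: lt_le_trans Sc.
have ell1 : 1 <= ell n by near: n; exact: ell_ge.
have ell2 : 1 <= eps / 2 * ell n.
  rewrite mulrC -ler_pdivrMr ?divr_gt0 //; near: n; exact: ell_ge.
have etac0 : 0 < eta * c0 by exact: mulr_gt0.
have ell3 : 8 * (1 + eps) <= eta * c0 * ell n.
  rewrite [leRHS]mulrC -ler_pdivrMr //; near: n; exact: ell_ge.
(* Makes the error [4 * expR (1 - eps / 2 * ell)] at most [e], through [expR (x - 1) >= x]. *)
have ell4 : 4 / e <= eps / 2 * ell n.
  rewrite [leRHS]mulrC -ler_pdivrMr ?divr_gt0 //; near: n; exact: ell_ge.
(* If [Qn] were 0, the logarithm would be taken at 0, where its value is 0 by convention, against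
   [ell >= 1]. *)
have Q0 : Qn R (d n) < 0.
  rewrite lt_neqAle; apply/andP; split; last by near: n.
  apply: contraTneq ell1 => Q0; rewrite /ell Q0 normr0 expr0n /= !mul0r ln0 //.
  by rewrite -ltNge.
have Kn := threshold_le_drift eps0 eta0 c00 Sc (ltr0_neq0 Q0) n0 (le_trans ler01 ell1) ell3.
have Qc : Qn R (d n) ^+ 2 <= Rn R (d n) by apply: le_trans Sc; near: n.
have DQn : (max_degree (d n))%:R * `|Qn R (d n)| <= eta / 2 * Rn R (d n) by near: n.
have low := CM_L1_upper d0 eps0 mev n0 Q0 S0 Qc DQn ell1 ell2 Kn.
set prob := CM_pr _ _ _ in low *.
have prob1 : prob <= 1.
  rewrite -(CM_pr_complement R (fun G => (L1 G)%:R <=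
    (1 + eps) * (2 * Rn R (d n) / Qn R (d n) ^+ 2) * ell n) mev).
  by rewrite lerDl divr_ge0.
rewrite ger0_norm ?subr_ge0 // lerBlDr -lerBlDl; apply: le_trans low.
rewrite lerB // -/(ell n).
have x0 : 0 < eps / 2 * ell n by apply: lt_le_trans ell2.
rewrite -[expR _]invrK -expRN opprB ler_pdivrMr ?expR_gt0 //.
rewrite mulrC -ler_pdivrMr //; apply: le_trans ell4 _.
by have := expR_ge1Dx (eps / 2 * ell n - 1); lra.
Unshelve. all: by end_near.
Qed.
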